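(* Let $k\ge 4$ be an even integer and let $n\ge 3k$ be an integer. Then $\tilde{r}(C_k,C_n)\le 2n+20k$.
   Context: The online Ramsey game is played between Builder and Painter on the infinite complete graph $K_{\mathbb N}$. In each round Builder selects a previously unselected edge of $K_{\mathbb N}$ and Painter colors it red or blue. For finite graphs $G_1,G_2$, the game ends as soon as the graph formed by all colored edges contains a red copy of $G_1$ or a blue copy of $G_2$; Builder wants to end the game as soon as possible and Painter wants to delay the end. The online Ramsey number $\tilde{r}(G_1,G_2)$ is the minimum number of rounds within which Builder can guarantee the end of the game, both players playing optimally. $C_k$ denotes the cycle on $k$ vertices. *)

(* Defs.v *)
From mathcomp Require Import all_boot.

Set Implicit Arguments.
Unset Strict Implicit.
Unset Printing Implicit Defensive.

Record sgraph := SGraph {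
  vertex :> finType;
  adj : rel vertex;
  adj_sym : symmetric adj;
  adj_irrefl : irreflexive adj }.

(* The conjunct [i != j] only matters for k = 1, where it keeps the relation
   irreflexive; otherwise the successor modulo k of i is distinct from i. *)
Definition cycle_adj (k : nat) : rel 'I_k :=
  [rel i j : 'I_k |
    (i != j) && ((val j == i.+1 %% k) || (val i == j.+1 %% k))].

Lemma cycle_adj_sym k : symmetric (@cycle_adj k).
Proof. by move=> i j; rewrite /cycle_adj /= eq_sym orbC. Qed.

Lemma cycle_adj_irrefl k : irreflexive (@cycle_adj k).
Proof. by move=> i; rewrite /cycle_adj /= eqxx. Qed.

Definition cycle_graph (k : nat) : sgraph :=
  SGraph (@cycle_adj_sym k) (@cycle_adj_irrefl k).

(* An edge {u, v} of the complete graph on nat is stored as the ordered pair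
   (u, v) with u < v, so that each edge has a single representation. *)
Notation edge := {e : nat * nat | e.1 < e.2}.

Notation color := bool (only parsing).
Definition red : color := true.
Definition blue : color := false.

(* The rounds played so far, oldest first: the edge selected by Builder and the
   color it received from Painter. *)
Notation history := (seq (edge * color)).

Definition selected (h : history) : seq edge := [seq m.1 | m <- h].

Definition colored_adj (h : history) (c : color) : rel nat :=
  fun u v => has (fun m : edge * color =>
    (val m.1 == (minn u v, maxn u v)) && (m.2 == c)) h.

(* Copies are not required to be induced. *)
Definition has_copy (G : sgraph) (h : history) (c : color) : Prop :=
  exists2 f : G -> nat, injective f &
    forall x y : G, adj x y -> colored_adj h c (f x) (f y).

Definition game_over (G1 G2 : sgraph) (h : history) : Prop :=
  has_copy G1 h red \/ has_copy G2 h blue.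

(* Every finite history leaves infinitely many edges unselected, so legality can
   be required at all histories, reachable or not, at no loss of generality. *)
Definition legal (sigma : history -> edge) : Prop :=
  forall h : history, sigma h \notin selected h.

Fixpoint play (sigma : history -> edge) (tau : history -> edge -> color)
    (t : nat) : history :=
  if t is s.+1 then
    let h := play sigma tau s in
    let e := sigma h in rcons h (e, tau h e)
  else [::].

(* [play] does not stop when the game is over; the game ends at the first s for
   which [game_over] holds, and only the existence of such an s <= t matters. *)
Definition builder_ends_within (G1 G2 : sgraph) (t : nat) : Prop :=
  exists2 sigma : history -> edge, legal sigma &
    forall tau : history -> edge -> color,
      exists2 s, s <= t & game_over G1 G2 (play sigma tau s).

(* [r] is the online Ramsey number of (G1, G2): a minimum that is attained. *)
Definition is_online_ramsey (G1 G2 : sgraph) (r : nat) : Prop :=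
  builder_ends_within G1 G2 r /\
  forall t : nat, builder_ends_within G1 G2 t -> r <= t.

Lemma is_online_ramsey_uniq G1 G2 r r' :
  is_online_ramsey G1 G2 r -> is_online_ramsey G1 G2 r' -> r = r'.
Proof.
move=> [wr minr] [wr' minr']; apply/eqP.
by rewrite eqn_leq minr // minr'.
Qed.

(* Main.v *)
Require Import Defs.
From mathcomp Require Import all_boot zify.
From Stdlib Require Import Classical IndefiniteDescription.

Set Implicit Arguments.
Unset Strict Implicit.
Unset Printing Implicit Defensive.

(** Builder keeps a stack of disjoint blue paths ("levels"), both ends of each
    being joined in red to the last vertex of the level below. A new vertex is
    joined to the last vertex of the top level: a red answer opens a new level,
    and after a blue answer the new end is attached to the level below. Thus a
    vertex costs at most two rounds, and N vertices on M levels cost at most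
    2N - M - 1. The last vertices of the levels form a red path, so level i and
    level i + (k - 1) can be joined by a forced blue edge, and at most k - 1 blue
    paths remain.

    These are merged at constant amortized cost with the help of a red path, the
    hub, disjoint from them: an end of a blue path either gets a blue edge to an
    end r of the hub, or extends it; two blue paths with blue edges to r are
    merged through r. Once the hub has k - 1 vertices, every vertex has a blue
    edge to one of its two ends, so that among three blue paths two can be merged.

    The last two paths are merged, and the result is closed into a blue cycle with
    n, n + 1 or n + 2 vertices, by asking for the edges of a "ladder", a cycle of
    even length k consisting of two parallel paths and two rungs, not all of which
    can be red. A cycle with n + 2 vertices is shortened in the same way. In a
    cycle with n + 1 vertices all chords at distance 2 are red unless one of them
    yields a blue C_n; k - 1 consecutive ones force a blue chord, a crossing chord
    is then red or else it yields a blue C_n, and two such crossing chords are the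
    rungs of a red ladder. *)

(** * Positions of the game and the passage to strategies *)

Lemma colored_adj_sym (h : history) (c : color) : symmetric (colored_adj h c).
Proof. by move=> u v; rewrite /colored_adj minnC maxnC. Qed.

(** Later arguments use only that colored edges persist, so histories are compared by their colored
    graphs and not as sequences. *)
Definition extends (h h' : history) : Prop :=
  forall c, subrel (colored_adj h c) (colored_adj h' c).

Lemma extends_refl (h : history) : extends h h.
Proof. by move=> c u v. Qed.

Lemma extends_trans (h1 h2 h3 : history) :
  extends h1 h2 -> extends h2 h3 -> extends h1 h3.
Proof. by move=> h12 h23 c u v /h12 /h23. Qed.

Lemma extends_rcons (h : history) (m : edge * color) : extends h (rcons h m).
Proof. by move=> c u v; rewrite /colored_adj has_rcons => ->; rewrite orbT. Qed.

Lemma extends_sorted (h h' : history) (c : color) (s : seq nat) :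
  extends h h' -> sorted (colored_adj h c) s -> sorted (colored_adj h' c) s.
Proof. by move=> hh'; apply: sub_sorted; apply: hh'. Qed.

Lemma extends_cycle (h h' : history) (c : color) (s : seq nat) :
  extends h h' -> cycle (colored_adj h c) s -> cycle (colored_adj h' c) s.
Proof. by move=> hh'; apply: sub_cycle; apply: hh'. Qed.

(** Builder's winning positions, by recursion on the rounds left. Painter's answer is a universally
    quantified color in each round, so no Painter strategy has to be carried along. *)
Fixpoint wins (G1 G2 : sgraph) (t : nat) (h : history) : Prop :=
  game_over G1 G2 h \/
  if t is s.+1 then
    exists2 e : edge, e \notin selected h &
      forall c : color, wins G1 G2 s (rcons h (e, c))
  else False.

Arguments wins : simpl never.

Lemma winsS (G1 G2 : sgraph) (t : nat) (h : history) :
  wins G1 G2 t h -> wins G1 G2 t.+1 h.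
Proof.
elim: t h => [|t IHt] h /= [over | ]; try by left.
by move=> [e fresh_e win_e]; right; exists e => // c; apply: IHt; apply: win_e.
Qed.

Lemma wins_leq (G1 G2 : sgraph) (t t' : nat) (h : history) :
  t <= t' -> wins G1 G2 t h -> wins G1 G2 t' h.
Proof.
move/subnKC <-; elim: (t' - t) => [|d IHd] win_t; first by rewrite addn0.
by rewrite addnS; apply: winsS; apply: IHd.
Qed.

Lemma wins_over (G1 G2 : sgraph) (t : nat) (h : history) :
  game_over G1 G2 h -> wins G1 G2 t h.
Proof. by case: t => [|t] over; left. Qed.

Lemma edge_of_neq (u v : nat) :
  u != v -> exists e : edge, val e = (minn u v, maxn u v).
Proof.
move=> neq_uv; have lt_uv : (minn u v, maxn u v).1 < (minn u v, maxn u v).2.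
  by rewrite /=; lia.
by exists (exist (fun e : nat * nat => e.1 < e.2) _ lt_uv).
Qed.

(* If the edge has already been selected, no round is spent. *)
Lemma wins_query (G1 G2 : sgraph) (t : nat) (h : history) (u v : nat) :
  u != v ->
  (forall h', extends h h' -> colored_adj h' red u v -> wins G1 G2 t h') ->
  (forall h', extends h h' -> colored_adj h' blue u v -> wins G1 G2 t h') ->
  wins G1 G2 t.+1 h.
Proof.
move=> /edge_of_neq [e val_e] win_red win_blue.
have win_col h' c : extends h h' -> colored_adj h' c u v -> wins G1 G2 t h'.
  by case: c; [apply: win_red | apply: win_blue].
have [/mapP [m m_h e_m] | fresh_e] := boolP (e \in selected h).
  apply/winsS/(win_col h m.2); first exact: extends_refl.
  by apply/hasP; exists m => //; rewrite -e_m val_e !eqxx.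
right; exists e => // c; apply: (win_col _ c); first exact: extends_rcons.
by rewrite /colored_adj has_rcons /= val_e !eqxx.
Qed.

(** Builder asks for the edges in turn and breaks off at the first blue answer; the rounds saved are
    given away by [wins_leq]. *)
Lemma wins_query_all (G1 G2 : sgraph) (t : nat) (es : seq (nat * nat))
    (h : history) :
  all (fun e => e.1 != e.2) es ->
  (forall h' e, extends h h' -> e \in es -> colored_adj h' blue e.1 e.2 ->
    wins G1 G2 t h') ->
  (forall h', extends h h' ->
    all (fun e => colored_adj h' red e.1 e.2) es -> wins G1 G2 t h') ->
  wins G1 G2 (size es + t) h.
Proof.
elim: es h => [|e es IHes] h /=.
  by move=> _ _; apply; first exact: extends_refl.
move=> /andP [e_ok es_ok] win_blue win_red; apply: (wins_query e_ok) => h' hh' col.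
- apply: IHes => // [h'' f h'h'' f_es | h'' h'h'' all_red].
    by apply: win_blue; [exact: extends_trans h'h'' | rewrite inE f_es orbT].
  apply: win_red; first exact: extends_trans h'h''.
  by rewrite all_red andbT; apply: h'h''.
- apply: (@wins_leq _ _ t); first exact: leq_addl.
  by apply: (win_blue _ e) => //; rewrite mem_head.
Qed.

Lemma fresh_edge (h : history) : exists e : edge, e \notin selected h.
Proof.
pose b := (foldr maxn 0 [seq (val e).2 | e <- selected h]).+1.
exists (exist (fun e : nat * nat => e.1 < e.2) (0, b) (ltn0Sn _)).
apply/negP; set e0 := exist _ _ _ => e0_h.
suff: (val e0).2 < b by rewrite /= ltnn.
rewrite /b ltnS; elim: (selected h) e0_h => //= e s IHs.
by rewrite inE leq_max => /orP [/eqP <- | /IHs ->]; rewrite ?leqnn ?orbT.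
Qed.

(** A strategy sees the history but not the number of rounds left, so one edge has to serve every
    [t]: the edge for the least winning [t] is good for all larger ones. Where the game is over or
    not winning, any fresh edge keeps the strategy legal. *)
Lemma wins_strategy (G1 G2 : sgraph) :
  exists2 sigma : history -> edge, legal sigma &
    forall t h, wins G1 G2 t.+1 h -> ~ game_over G1 G2 h ->
      forall c, wins G1 G2 t (rcons h (sigma h, c)).
Proof.
have good_edge h : exists e : edge, e \notin selected h /\
    forall t, wins G1 G2 t.+1 h -> ~ game_over G1 G2 h ->
      forall c, wins G1 G2 t (rcons h (e, c)).
  have [[t0 win0] | never] := classic (exists t, wins G1 G2 t h); last first.
    have [e fresh_e] := fresh_edge h.
    by exists e; split=> // t win_t; case: never; exists t.+1.
  have [over | not_over] := classic (game_over G1 G2 h).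
    by have [e fresh_e] := fresh_edge h; exists e.
  (* Descend to the least [t] for which [h] is winning. *)
  elim: t0 win0 => [|t IHt] win_t; first by case: win_t.
  have [/IHt // | not_win] := classic (wins G1 G2 t h).
  case: win_t => // -[e fresh_e win_e]; exists e; split=> // t' win_t' _ c.
  have [le_tt' | lt_t't] := leqP t t'; first exact: wins_leq le_tt' (win_e c).
  by case: not_win; apply: wins_leq win_t'.
exists (fun h => sval (constructive_indefinite_description _ (good_edge h))).
  by move=> h; case: constructive_indefinite_description => e [].
move=> t h win_t not_over; case: constructive_indefinite_description => e [_ /=].
by move=> /(_ t win_t not_over).
Qed.

(** Invariant along a play: the game has ended, or the position is winning within the remaining
    [t - s] rounds. *)
Lemma wins_builder (G1 G2 : sgraph) (t : nat) :
  wins G1 G2 t [::] -> builder_ends_within G1 G2 t.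
Proof.
move=> win_t; have [sigma legal_sigma step] := wins_strategy G1 G2.
exists sigma => // tau.
suff ind s : s <= t ->
    (exists2 s', s' <= t & game_over G1 G2 (play sigma tau s')) \/
    wins G1 G2 (t - s) (play sigma tau s).
  have [//|] := ind t (leqnn t); rewrite subnn => -[over | []].
  by exists t.
elim: s => [|s IHs] lt_st; first by rewrite subn0; right.
have [|win_s] := IHs (ltnW lt_st); first by left.
have [over | not_over] := classic (game_over G1 G2 (play sigma tau s)).
  by left; exists s => //; apply: ltnW.
by right; apply: step => //; rewrite -subSn.
Qed.

Lemma builder_online_ramsey (G1 G2 : sgraph) (t : nat) :
  builder_ends_within G1 G2 t ->
  exists2 r, is_online_ramsey G1 G2 r & r <= t.
Proof.
elim/ltn_ind: t => t IHt end_t.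
have [[t' [lt_t't end_t']] | no_less] :=
  classic (exists t', t' < t /\ builder_ends_within G1 G2 t').
  have [r ram_r le_rt'] := IHt t' lt_t't end_t'.
  by exists r => //; apply: leq_trans le_rt' (ltnW lt_t't).
exists t => //; split=> // t' end_t'; rewrite leqNgt; apply/negP => lt_t't.
by case: no_less; exists t'.
Qed.

(** * Cycles and ladders *)

Lemma cycle_nth (T : eqType) (x0 : T) (e : rel T) (s : seq T) (i : nat) :
  cycle e s -> i < size s -> e (nth x0 s i) (nth x0 s (i.+1 %% size s)).
Proof.
case: s => // x p /= /(pathP x0) /(_ i); rewrite size_rcons => cyc lt_i.
have := cyc lt_i; rewrite -rcons_cons !nth_rcons /= lt_i.
have [lt_ip | ] := ltnP i (size p); first by rewrite modn_small.
move=> le_pi; have -> : i = size p by lia.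
by rewrite eqxx modnn.
Qed.

Lemma copy_of_cycle (h : history) (c : color) (s : seq nat) :
  uniq s -> cycle (colored_adj h c) s -> has_copy (cycle_graph (size s)) h c.
Proof.
move=> uniq_s cyc_s; exists (fun i : 'I_(size s) => nth 0 s i).
  by move=> i j /eqP; rewrite nth_uniq // => /eqP /val_inj.
move=> i j /= /andP [_ /orP [/eqP -> | /eqP ->]]; first exact: cycle_nth.
by rewrite colored_adj_sym; apply: cycle_nth.
Qed.

Lemma red_cycle_wins (n t : nat) (h : history) (s : seq nat) :
  uniq s -> cycle (colored_adj h red) s ->
  wins (cycle_graph (size s)) (cycle_graph n) t h.
Proof. by move=> us cs; apply: wins_over; left; apply: copy_of_cycle. Qed.

Lemma blue_cycle_wins (k t : nat) (h : history) (s : seq nat) :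
  uniq s -> cycle (colored_adj h blue) s ->
  wins (cycle_graph k) (cycle_graph (size s)) t h.
Proof. by move=> us cs; apply: wins_over; right; apply: copy_of_cycle. Qed.

(** A red answer would close the red path into a red cycle on [(size p).+1] vertices, so only the
    blue answer has to be continued. *)
Lemma wins_forced (n t : nat) (h : history) (x : nat) (p : seq nat) :
  p != [::] -> uniq (x :: p) -> path (colored_adj h red) x p ->
  (forall h', extends h h' -> colored_adj h' blue (last x p) x ->
    wins (cycle_graph (size p).+1) (cycle_graph n) t h') ->
  wins (cycle_graph (size p).+1) (cycle_graph n) t.+1 h.
Proof.
move=> p_n0 uniq_xp path_p win_blue; apply: wins_query win_blue.
  case/andP: uniq_xp => x_p _; apply: contraNneq x_p => <-.
  by case: {path_p} p p_n0 => // y q _; apply: mem_last.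
move=> h' hh' red_x; apply: (@red_cycle_wins _ _ _ (x :: p)) => //=.
by rewrite rcons_path red_x andbT; apply: sub_path path_p; apply: hh'.
Qed.

Lemma sorted_cat2 (T : Type) (x0 : T) (e : rel T) (s1 s2 : seq T) :
  0 < size s1 -> 0 < size s2 ->
  sorted e (s1 ++ s2) =
    [&& sorted e s1, e (last x0 s1) (head x0 s2) & sorted e s2].
Proof. by case: s1 s2 => // x s1 [|y s2] //= _ _; rewrite cat_path. Qed.

Lemma cycle_sorted (T : Type) (x0 : T) (e : rel T) (s : seq T) :
  0 < size s -> cycle e s = sorted e s && e (last x0 s) (head x0 s).
Proof. by case: s => // x s _ /=; rewrite rcons_path. Qed.

Lemma rev_sorted_sym (T : Type) (e : rel T) (s : seq T) :
  symmetric e -> sorted e (rev s) = sorted e s.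
Proof.
by move=> sym_e; rewrite rev_sorted; apply: eq_sorted => x y; rewrite sym_e.
Qed.

Lemma head_rev_last (T : Type) (x0 : T) (s : seq T) :
  head x0 (rev s) = last x0 s.
Proof. by case/lastP: s => // s x; rewrite rev_rcons last_rcons. Qed.

Lemma last_rev_head (T : Type) (x0 : T) (s : seq T) :
  last x0 (rev s) = head x0 s.
Proof. by rewrite -head_rev_last revK. Qed.

Lemma sorted_mkseq (T : Type) (e : rel T) (f : nat -> T) (m : nat) :
  (forall i, i.+1 < m -> e (f i) (f i.+1)) -> sorted e (mkseq f m).
Proof.
move=> step; apply/(sortedP (f 0)) => i; rewrite size_mkseq => lt_i.
by rewrite !nth_mkseq //; [apply: step | apply: ltnW].
Qed.

(** Go up along [f], cross the rung at [m], come back along [g] and close by the rung at [0]. *)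
Lemma cycle_ladder (T : Type) (e : rel T) (f g : nat -> T) (m : nat) :
  symmetric e ->
  (forall i, i < m -> e (f i) (f i.+1)) ->
  (forall i, i < m -> e (g i) (g i.+1)) ->
  e (f 0) (g 0) -> e (f m) (g m) ->
  cycle e (mkseq f m.+1 ++ rev (mkseq g m.+1)).
Proof.
move=> sym_e step_f step_g rung0 rungm.
have n0 (F : nat -> T) : 0 < size (mkseq F m.+1) by rewrite size_mkseq.
rewrite (cycle_sorted (f 0)) ?size_cat ?addn_gt0 ?n0 //.
rewrite (sorted_cat2 (f 0)) ?size_rev ?n0 // rev_sorted_sym // !sorted_mkseq //.
have last_mk (F : nat -> T) d : last d (mkseq F m.+1) = F m.
  by rewrite mkseqS last_rcons.
by rewrite last_cat last_rev_head head_rev_last !last_mk rungm /= sym_e.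
Qed.

(** If all answers are red, the two rails and the rungs at [0] and [m] form a red cycle on [m.*2.+2]
    vertices. Only these two rungs are asked for; [win_blue] covers all rungs [i <= m] so that they
    can be treated uniformly. *)
Lemma wins_query_ladder (n t : nat) (h : history) (f g : nat -> nat) (m : nat) :
  0 < m ->
  uniq (mkseq f m.+1 ++ mkseq g m.+1) ->
  (forall h' u v, extends h h' -> colored_adj h' blue u v ->
     (exists2 i, i < m & (u, v) = (f i, f i.+1) \/ (u, v) = (g i, g i.+1)) \/
     (exists2 i, i <= m & (u, v) = (f i, g i)) ->
     wins (cycle_graph m.*2.+2) (cycle_graph n) t h') ->
  wins (cycle_graph m.*2.+2) (cycle_graph n) (m.*2.+2 + t) h.
Proof.
move=> m_gt0 uniq_fg win_blue.
(* The boolean selects the rail; injectivity gives each queried edge distinct ends. *)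
have inj_fg b c i j : i <= m -> j <= m ->
    (if b then f i else g i) = (if c then f j else g j) -> b = c /\ i = j.
  move=> le_im le_jm.
  have at_fg b' i' : i' <= m -> (if b' then f i' else g i') =
      nth 0 (mkseq f m.+1 ++ mkseq g m.+1) (if b' then i' else m.+1 + i').
    rewrite nth_cat size_mkseq => le_i'; case: b'; first by rewrite ltnS le_i' nth_mkseq.
    by rewrite ltnNge leq_addr /= addKn nth_mkseq.
  have lt_fg b' i' : i' <= m ->
      (if b' then i' else m.+1 + i') < size (mkseq f m.+1 ++ mkseq g m.+1).
    by rewrite size_cat !size_mkseq; case: b'; lia.
  rewrite !at_fg // => /eqP; rewrite nth_uniq ?lt_fg // => /eqP.
  by case: b; case: c => eq_ij; [split | exfalso | exfalso | split]=> //; lia.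
pose es := [seq (f i, f i.+1) | i <- iota 0 m] ++
  [seq (g i, g i.+1) | i <- iota 0 m] ++ [:: (f 0, g 0); (f m, g m)].
have -> : m.*2.+2 + t = size es + t.
  by rewrite !size_cat !size_map !size_iota /= addnA addnn addn2.
have in_es e : e \in es ->
    (exists2 i, i < m & e = (f i, f i.+1) \/ e = (g i, g i.+1)) \/
    (exists2 i, i <= m & e = (f i, g i)).
  rewrite !mem_cat => /or3P [/mapP [i] | /mapP [i] | ].
  - by rewrite mem_iota => lt_i ->; left; exists i; [|left].
  - by rewrite mem_iota => lt_i ->; left; exists i; [|right].
  by rewrite !inE => /orP [] /eqP ->; right; [exists 0 | exists m].
apply: wins_query_all.
- apply/allP => e /in_es [[i lt_im [->|->]] | [i le_im ->]] /=; apply/eqP => eq_uv.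
  + by have [] := inj_fg true true i i.+1 (ltnW lt_im) lt_im eq_uv; lia.
  + by have [] := inj_fg false false i i.+1 (ltnW lt_im) lt_im eq_uv; lia.
  by have [] := inj_fg true false i i le_im le_im eq_uv.
- move=> h' [u v] hh' /in_es e_es blue_uv; exact: win_blue hh' blue_uv e_es.
move=> h' hh' /allP all_red.
have size_s : size (mkseq f m.+1 ++ rev (mkseq g m.+1)) = m.*2.+2.
  by rewrite size_cat size_rev !size_mkseq addnn doubleS.
rewrite -[in cycle_graph m.*2.+2]size_s; apply: red_cycle_wins.
  by rewrite (perm_uniq (_ : perm_eq _ (mkseq f m.+1 ++ mkseq g m.+1))) //
             perm_cat2l perm_rev.
have red_es e : e \in es -> colored_adj h' red e.1 e.2 by apply: all_red.
apply: cycle_ladder; first exact: colored_adj_sym.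
- by move=> i lt_i; apply: (red_es (_, _)); rewrite mem_cat map_f // mem_iota.
- move=> i lt_i; apply: (red_es (_, _)).
  by rewrite !mem_cat (map_f (fun i => (g i, g i.+1))) ?orbT // mem_iota.
- by apply: (red_es (_, _)); rewrite !mem_cat !inE eqxx !orbT.
by apply: (red_es (_, _)); rewrite !mem_cat !inE eqxx !orbT.
Qed.

Lemma flatten_cons (T : Type) (s : seq T) (ss : seq (seq T)) :
  flatten (s :: ss) = s ++ flatten ss.
Proof. by []. Qed.

(** Compares the counts of an arbitrary predicate on both sides, which is linear arithmetic. *)
Ltac perm_count :=
  clear; apply/permP => ?;
  repeat progress rewrite ?(flatten_cat, flatten_cons, count_cat, count_rev, =^~ cats1) /=;
  lia.

Lemma split_nth (T : Type) (x0 : T) (s : seq T) (i : nat) :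
  i < size s -> s = take i s ++ nth x0 s i :: drop i.+1 s.
Proof. by move=> lt_i; rewrite -drop_nth // cat_take_drop. Qed.

(** * Closing a blue path *)

(** The chord replaces the arc from [s_i] to [s_j] and drops the [j - i - 1] vertices strictly
    between them. *)
Lemma cycle_skip (x0 : nat) (e : rel nat) (s : seq nat) (i j : nat) :
  uniq s -> cycle e s -> i < j < size s -> e (nth x0 s i) (nth x0 s j) ->
  exists s' : seq nat, [/\ uniq s', cycle e s' & size s' = i.+1 + (size s - j)].
Proof.
move=> uniq_s cyc_s /andP [lt_ij lt_js] e_ij.
have lt_is := ltn_trans lt_ij lt_js.
set A := take i s; set B := take (j - i.+1) (drop i.+1 s).
set D := drop j.+1 s; set a := nth x0 s i; set b := nth x0 s j.
have def_s : s = A ++ a :: B ++ b :: D.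
  rewrite {1}(split_nth x0 lt_is) -(cat_take_drop (j - i.+1) (drop i.+1 s)).
  by rewrite drop_drop subnK // (drop_nth x0 lt_js).
have size_A : size A = i by rewrite size_takel // ltnW.
exists (a :: b :: D ++ A); split.
- apply: subseq_uniq (_ : uniq ((a :: B ++ b :: D) ++ A)).
    by rewrite /= eqxx -catA; apply: (suffix_subseq B).
  by rewrite (perm_uniq (permEl (perm_catC _ _))) -def_s.
(* Rotate the cycle to start at [a], so that the arc [B] to be cut out comes next. *)
- move: cyc_s; rewrite def_s -(rot_cycle (size A)) rot_size_cat /= -cats1 -!catA.
  rewrite cat_path /= => /and3P [_ _]; rewrite -/a -/b in e_ij; rewrite e_ij /=.
  by rewrite -cats1 -catA.
by rewrite /= size_cat size_A size_drop; lia.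
Qed.

(* Both chords are used: [s_i] is joined to [s_j], the arc from [s_j] down to
   [s_(i+1)] is traversed backwards, and [s_(i+1)] is joined to [s_(j+2)], which
   avoids the vertex [s_(j+1)] only. *)
Lemma cycle_cross (x0 : nat) (e : rel nat) (s : seq nat) (i j : nat) :
  symmetric e -> uniq s -> cycle e s -> i < j -> j.+2 < size s ->
  e (nth x0 s i) (nth x0 s j) -> e (nth x0 s i.+1) (nth x0 s j.+2) ->
  exists s' : seq nat, [/\ uniq s', cycle e s' & (size s').+1 = size s].
Proof.
move=> sym_e uniq_s cyc_s lt_ij lt_js e_ij e_ij'.
have lt_is : i < size s by lia.
set A := take i s; set B := take (j - i) (drop i.+1 s).
set D := drop j.+3 s; set a := nth x0 s i.
set y := nth x0 s j.+1; set d := nth x0 s j.+2.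
have def_s : s = A ++ a :: B ++ y :: d :: D.
  rewrite {1}(split_nth x0 lt_is) -(cat_take_drop (j - i) (drop i.+1 s)).
  rewrite drop_drop (_ : j - i + i.+1 = j.+1); last by lia.
  by rewrite (drop_nth x0 (_ : j.+1 < _)) 1?(drop_nth x0 lt_js) //; lia.
have size_A : size A = i by rewrite size_takel // ltnW.
have size_B : size B = j - i by rewrite size_takel // size_drop; lia.
have B_n0 : 0 < size B by rewrite size_B; lia.
have head_B : head x0 B = nth x0 s i.+1.
  by rewrite -nth0 nth_take ?nth_drop ?addn0 //; lia.
have last_B : last x0 B = nth x0 s j.
  by rewrite -nth_last size_B nth_take ?nth_drop; [congr nth|]; lia.
rewrite -head_B -last_B -/a -/d in e_ij e_ij'.
exists (a :: rev B ++ d :: D ++ A); split.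
- have perm_s : perm_eq s (y :: a :: rev B ++ d :: D ++ A).
    by rewrite def_s; perm_count.
  by move: uniq_s; rewrite (perm_uniq perm_s) /= => /andP [].
- move: cyc_s; rewrite {1}def_s -(rot_cycle (size A)) rot_size_cat /= -!cats1.
  rewrite -!catA /= -!catA; set Z := D ++ A ++ _; rewrite cat_path /=.
  move=> /and4P [path_B _ _ path_Z].
  rewrite -[path _ _ _]/(sorted e ([:: a] ++ rev B ++ d :: Z)).
  rewrite !(sorted_cat2 x0) ?size_cat ?size_rev ?addn_gt0 ?B_n0 //=.
  rewrite rev_sorted_sym // (path_sorted path_B) last_rev_head e_ij' path_Z.
  case: (rev B) (head_rev_last x0 B) (size_rev B) => [|b B'] /= last_rB; first by lia.
  by rewrite last_rB e_ij.
by rewrite def_s /= !size_cat /= !size_cat /= size_rev; lia.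
Qed.

Lemma mkseq_cons (T : Type) (f : nat -> T) (m : nat) :
  mkseq f m.+1 = f 0 :: mkseq (fun i => f i.+1) m.
Proof. by rewrite /mkseq /= (iotaDl 1 0 m) -map_comp. Qed.

Lemma uniq_mkseq_nth (s : seq nat) (f : nat -> nat) (m : nat) :
  uniq s -> (forall i, i < m -> f i < size s) ->
  (forall i j, i < m -> j < m -> f i = f j -> i = j) ->
  uniq (mkseq (fun i => nth 0 s (f i)) m).
Proof.
move=> uniq_s lt_f inj_f; apply/(uniqP 0) => i j; rewrite !inE size_mkseq.
move=> lt_i lt_j; rewrite !nth_mkseq // => /eqP; rewrite nth_uniq ?lt_f // => /eqP.
exact: inj_f.
Qed.

(** Reduces distinctness of the vertices of a ladder to arithmetic on positions. *)
Lemma uniq_mkseq2 (s : seq nat) (f g : nat -> nat) (m : nat) :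
  uniq s -> (forall i, i < m -> f i < size s) ->
  (forall i, i < m -> g i < size s) ->
  (forall i j, i < m -> j < m -> f i = f j -> i = j) ->
  (forall i j, i < m -> j < m -> g i = g j -> i = j) ->
  (forall i j, i < m -> j < m -> f i <> g j) ->
  uniq (mkseq (fun i => nth 0 s (f i)) m ++ mkseq (fun i => nth 0 s (g i)) m).
Proof.
move=> uniq_s lt_f lt_g inj_f inj_g neq_fg; rewrite cat_uniq !uniq_mkseq_nth //=.
rewrite andbT; apply/hasPn => x /mapP [j]; rewrite mem_iota => lt_j ->.
apply/negP => /mapP [i]; rewrite mem_iota => lt_i /eqP.
by rewrite nth_uniq ?lt_f ?lt_g // => /eqP /esym; apply: neq_fg.
Qed.

(** Ladder with rails on the positions 0, 2, 4, ... and 3, 5, 7, ...: a blue rail edge skips one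
    vertex and leaves [n.+1], a blue rung skips two and leaves [n]. *)
Lemma wins_shorten2 (m n t : nat) (h : history) (s : seq nat) :
  0 < m -> m.*2.+3 < n -> uniq s -> cycle (colored_adj h blue) s ->
  size s = n.+2 ->
  (forall h' (s' : seq nat), extends h h' -> uniq s' -> cycle (colored_adj h' blue) s' ->
     size s' = n.+1 -> wins (cycle_graph m.*2.+2) (cycle_graph n) t h') ->
  wins (cycle_graph m.*2.+2) (cycle_graph n) (m.*2.+2 + t) h.
Proof.
move=> m_gt0 lt_mn uniq_s cyc_s size_s win1.
pose f i := i.*2; pose g i := i.*2 + 3.
apply: (@wins_query_ladder _ _ _
  (fun i => nth 0 s (f i)) (fun i => nth 0 s (g i)) m) => //.
  by apply: uniq_mkseq2 => //; rewrite /f /g => *; lia.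
move=> h' u v hh' blue_uv uv_es.
have [i [j [lt_ij eq_ij blue_ij]]] : exists i j, [/\ i < j < size s,
    j = i.+2 \/ j = i.+3 & colored_adj h' blue (nth 0 s i) (nth 0 s j)].
  case: uv_es blue_uv => [[i lt_i [[-> ->]|[-> ->]]]|[i le_i [-> ->]]] blue_uv.
  - by exists (f i), (f i.+1); rewrite /f in blue_uv *; split => //; [lia | left; lia].
  - by exists (g i), (g i.+1); rewrite /g in blue_uv *; split => //; [lia | left; lia].
  by exists (f i), (g i); rewrite /f /g in blue_uv *; split => //; [lia | right; lia].
have [s' [uniq_s' cyc_s' size_s']] :=
  cycle_skip uniq_s (extends_cycle hh' cyc_s) lt_ij blue_ij.
case: eq_ij => def_j; first by apply: win1 hh' uniq_s' cyc_s' _; lia.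
by rewrite (_ : n = size s'); [apply: blue_cycle_wins | lia].
Qed.

(** The final red ladder has the rails 1, 3, ..., 2m+1 and 2k, 2k+2, ..., 2k+2m; its rungs join 1 to
    2k and 2m+1 to 2k+2m. *)
Lemma wins_shorten1 (k m n : nat) (h : history) (s : seq nat) :
  k = m.*2.+2 -> 0 < m -> 3 * k <= n -> uniq s ->
  cycle (colored_adj h blue) s -> size s = n.+1 ->
  wins (cycle_graph k) (cycle_graph n) (k.*2 + 2) h.
Proof.
move=> def_k m_gt0 le_kn uniq_s cyc_s size_s.
have def_k1 : k = k.-1.+1 by lia.
have win_skip h' i t : extends h h' -> i.+2 < size s ->
    colored_adj h' blue (nth 0 s i) (nth 0 s i.+2) ->
    wins (cycle_graph k) (cycle_graph n) t h'.
  move=> hh' lt_i blue_i; have [|s' [uniq_s' cyc_s' size_s']] :=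
    cycle_skip uniq_s (extends_cycle hh' cyc_s) _ blue_i; first by lia.
  by rewrite (_ : n = size s'); [apply: blue_cycle_wins | lia].
(* The red chords force [i.*2, i.*2 + k.*2 - 2] to be blue, and then the next
   chord is red by [cycle_cross]. *)
have win_chord h' i t : extends h h' -> i.*2 + k.*2 < size s ->
    (forall j, i <= j < i + k.-1 ->
       colored_adj h' red (nth 0 s j.*2) (nth 0 s j.*2.+2)) ->
    (forall h'', extends h' h'' ->
       colored_adj h'' red (nth 0 s i.*2.+1) (nth 0 s (i.*2 + k.*2)) ->
       wins (cycle_graph k) (cycle_graph n) t h'') ->
    wins (cycle_graph k) (cycle_graph n) t.+2 h'.
  move=> hh' lt_i red_rail win_red.
  have lt_i1 : i.*2.+1 < size s by lia.
  have neq_i : i.*2.+1 != i.*2 + k.*2 by lia.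
  pose p := mkseq (fun j => nth 0 s (i + j.+1).*2) k.-1.
  have size_p : size p = k.-1 by rewrite size_mkseq.
  have last_p d : last d p = nth 0 s (i.*2 + k.*2 - 2).
    have def_k2 : k.-1 = k.-2.+1 by lia.
    by rewrite /p def_k2 mkseqS last_rcons; congr nth; lia.
  have def_p : nth 0 s (i + 0).*2 :: p = mkseq (fun j => nth 0 s (i + j).*2) k.
    by rewrite [in RHS]def_k1 mkseq_cons.
  rewrite def_k1 -size_p.
  apply: (@wins_forced _ _ _ (nth 0 s (i + 0).*2)).
  - by rewrite -size_eq0 size_p; lia.
  - rewrite def_p; apply: uniq_mkseq_nth => // [j lt_j | j j' _ _]; lia.
  - rewrite -[path _ _ _]/(sorted _ (_ :: p)) def_p; apply: sorted_mkseq => j lt_j.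
    by rewrite addnS doubleS; apply: red_rail; lia.
  rewrite size_p last_p addn0 -def_k1 => h2 hh2 blue_chord.
  apply: wins_query => [|h3 hh3 /(win_red h3) |h3 hh3 blue_cross].
  - by rewrite nth_uniq.
  - by apply; apply: extends_trans hh3.
  have [||||s' [uniq_s' cyc_s' size_s']] := @cycle_cross 0 (colored_adj h3 blue) s
    i.*2 (i.*2 + k.*2 - 2) (colored_adj_sym _ _) uniq_s
    (extends_cycle (extends_trans (extends_trans hh' hh2) hh3) cyc_s).
  - by lia.
  - by lia.
  - by rewrite colored_adj_sym; apply: hh3.
  - by rewrite (_ : (_ - _).+2 = i.*2 + k.*2) //; lia.
  by rewrite (_ : n = size s'); [apply: blue_cycle_wins | lia].
have lt_ev i : i < k + m -> i.*2.+2 < size s by lia.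
have lt_od i : i < m -> i.*2.+3 < size s by lia.
have neq2 j : j != j.+2 by lia.
(* The even chords serve the forcing arguments at [0] and [m] and the upper rail. With the odd
   chords they take [2k - 2] rounds; the two crossing steps take two rounds each. *)
pose ev := iota 0 (k + m); pose od := iota 0 m.
pose es := [seq (nth 0 s i.*2, nth 0 s i.*2.+2) | i <- ev] ++
           [seq (nth 0 s i.*2.+1, nth 0 s i.*2.+3) | i <- od].
have -> : k.*2 + 2 = size es + 4.
  by rewrite size_cat !size_map !size_iota; lia.
apply: wins_query_all.
- apply/allP => e; rewrite mem_cat => /orP [] /mapP [i]; rewrite mem_iota.
    by move=> /lt_ev lt_i -> /=; rewrite nth_uniq // 2?ltnW.
  by move=> /lt_od lt_i -> /=; rewrite nth_uniq // 2?ltnW.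
- move=> h' e hh'; rewrite mem_cat => /orP [] /mapP [i]; rewrite mem_iota.
    by move=> /lt_ev lt_i ->; apply: win_skip.
  by move=> /lt_od lt_i ->; apply: win_skip.
move=> h1 hh1 /allP all_red.
have red_ev i : i < k + m ->
    colored_adj h1 red (nth 0 s i.*2) (nth 0 s i.*2.+2).
  move=> lt_i; apply: (all_red (_, _)); rewrite mem_cat.
  by rewrite (map_f (fun i => (_ i.*2, _ i.*2.+2))) // mem_iota.
have red_od i : i < m ->
    colored_adj h1 red (nth 0 s i.*2.+1) (nth 0 s i.*2.+3).
  move=> lt_i; apply: (all_red (_, _)); rewrite mem_cat.
  by rewrite (map_f (fun i => (_ i.*2.+1, _ i.*2.+3))) ?orbT // mem_iota.
apply: (win_chord h1 0 2) => // [|j lt_j|h2 hh2 rung0].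
- by lia.
- by apply: red_ev; lia.
apply: (win_chord h2 m 0) => [||j lt_j|h3 hh3 rungm].
- exact: extends_trans hh2.
- by lia.
- by apply/hh2/red_ev; lia.
have size_z (f g : nat -> nat) : size (mkseq f m.+1 ++ rev (mkseq g m.+1)) = k.
  by rewrite size_cat size_rev !size_mkseq; lia.
pose f i := i.*2.+1; pose g i := i.*2 + k.*2.
rewrite -(size_z (fun i => nth 0 s (f i)) (fun i => nth 0 s (g i))).
apply: red_cycle_wins.
  rewrite (perm_uniq (_ : perm_eq _
    (mkseq (fun i => nth 0 s (f i)) m.+1 ++ mkseq (fun i => nth 0 s (g i)) m.+1))).
    by apply: uniq_mkseq2 => //; rewrite /f /g => *; lia.
  by rewrite perm_cat2l perm_rev.
have hh13 := extends_trans hh2 hh3.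
apply: cycle_ladder; first exact: colored_adj_sym.
- by move=> i lt_i; apply/hh13; apply: red_od.
- move=> i lt_i; apply/hh13; have := red_ev (i + k); rewrite /g doubleD doubleS.
  by rewrite !addSn => -> //; lia.
- by apply: hh3; apply: rung0.
exact: rungm.
Qed.

Lemma cycle_of_path (x0 : nat) (e : rel nat) (s : seq nat) (i j : nat) :
  symmetric e -> uniq s -> sorted e s -> i <= j < size s ->
  e (nth x0 s i) (nth x0 s j) ->
  exists s' : seq nat, [/\ uniq s', cycle e s' & size s' = (j - i).+1].
Proof.
move=> sym_e uniq_s path_s lt_ij e_ij.
set s' := take (j - i).+1 (drop i s).
have size_s' : size s' = (j - i).+1 by rewrite size_takel // size_drop; lia.
exists s'; split=> //; first by rewrite take_uniq // drop_uniq.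
rewrite (cycle_sorted x0) ?size_s' // take_sorted ?drop_sorted //=.
rewrite -nth_last -nth0 size_s' !nth_take // !nth_drop addn0 sym_e.
by rewrite (_ : i + (j - i).+1.-1 = j) //; lia.
Qed.

(** The ladder zigzags between the first [m.+1] positions and those shifted by [n]: rail edges span
    [n.-1] or [n.+1] steps of the path and rungs span [n], so a blue edge closes a cycle on [n],
    [n.+2] or [n.+1] vertices. *)
Lemma wins_long_path (k m n : nat) (h : history) (s : seq nat) :
  k = m.*2.+2 -> 0 < m -> 3 * k <= n -> uniq s ->
  sorted (colored_adj h blue) s -> n + m < size s ->
  wins (cycle_graph k) (cycle_graph n) (4 * k + 2) h.
Proof.
move=> def_k m_gt0 le_kn uniq_s path_s size_s.
(* The costs of this ladder, of [wins_shorten2] and of [wins_shorten1]. *)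
have -> : 4 * k + 2 = m.*2.+2 + (m.*2.+2 + (k.*2 + 2)) by lia.
pose f i := if odd i then n + i else i; pose g i := if odd i then i else n + i.
rewrite [in cycle_graph k]def_k; apply: (@wins_query_ladder _ _ _
  (fun i => nth 0 s (f i)) (fun i => nth 0 s (g i)) m) => //.
  by apply: uniq_mkseq2 => //; rewrite /f /g => i; [case: ifP | case: ifP | | | ];
    try (move=> j; case: ifP; case: ifP); lia.
move=> h' u v hh' blue_uv uv_es.
have [i [j [lt_ij eq_ij blue_ij]]] : exists i j, [/\ i <= j < size s,
    [\/ j = i + n.-1, j = i + n | j = i + n.+1] &
    colored_adj h' blue (nth 0 s i) (nth 0 s j)].
  have sym_h' := colored_adj_sym h' blue.
  case: uv_es blue_uv => [[i lt_i [[-> ->]|[-> ->]]]|[i le_i [-> ->]]];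
    rewrite /f /g; case: (boolP (odd i)) => odd_i /=; rewrite ?odd_i /= => blue_uv.
  - exists i.+1, (n + i); split; [lia | constructor 1; lia | by rewrite sym_h'].
  - by exists i, (n + i.+1); split=> //; [lia | constructor 3; lia].
  - by exists i, (n + i.+1); split=> //; [lia | constructor 3; lia].
  - exists i.+1, (n + i); split; [lia | constructor 1; lia | by rewrite sym_h'].
  - exists i, (n + i); split; [lia | constructor 2; lia | by rewrite sym_h'].
  by exists i, (n + i); split=> //; [lia | constructor 2; lia].
have [s' [uniq_s' cyc_s' size_s']] := cycle_of_path (colored_adj_sym _ _)
  uniq_s (extends_sorted hh' path_s) lt_ij blue_ij.
case: eq_ij => def_j.
- by rewrite (_ : n = size s'); [apply: blue_cycle_wins | lia].
- apply: (@wins_leq _ _ (k.*2 + 2)); first by lia.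
  by rewrite -def_k; apply: (wins_shorten1 def_k m_gt0 le_kn uniq_s' cyc_s'); lia.
apply: (wins_shorten2 m_gt0 _ uniq_s' cyc_s'); [lia | lia | ].
move=> h2 s2 _ uniq_s2 cyc_s2 size_s2; rewrite -def_k.
exact: wins_shorten1 def_k m_gt0 le_kn uniq_s2 cyc_s2 size_s2.
Qed.

(** Every edge of a zigzag ladder between the end of [p] and the start of [q] joins the two paths. A
    blue one merges them at a loss of at most [2m < k] vertices; if one path has at most [m]
    vertices, the other suffices alone. *)
Lemma wins_two_paths (k m n : nat) (h : history) (p q : seq nat) :
  k = m.*2.+2 -> 0 < m -> 3 * k <= n -> uniq (p ++ q) ->
  sorted (colored_adj h blue) p -> sorted (colored_adj h blue) q ->
  n + m + k < size (p ++ q) ->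
  wins (cycle_graph k) (cycle_graph n) (5 * k + 2) h.
Proof.
move=> def_k m_gt0 le_kn uniq_pq path_p path_q size_pq.
have -> : 5 * k + 2 = m.*2.+2 + (4 * k + 2) by lia.
have := uniq_pq; rewrite cat_uniq => /and3P [uniq_p _ uniq_q].
have := size_pq; rewrite size_cat => size_pq'.
have [le_pm | lt_mp] := leqP (size p) m.
  apply: (@wins_leq _ _ (4 * k + 2)); first by lia.
  by apply: (wins_long_path def_k m_gt0 le_kn uniq_q path_q); lia.
have [le_qm | lt_mq] := leqP (size q) m.
  apply: (@wins_leq _ _ (4 * k + 2)); first by lia.
  by apply: (wins_long_path def_k m_gt0 le_kn uniq_p path_p); lia.
(* Positions in [p ++ q], counted from the junction of [p] and [q]. *)
pose a i := (size p).-1 - i; pose b i := size p + i.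
pose f i := if odd i then b i else a i; pose g i := if odd i then a i else b i.
rewrite [in cycle_graph k]def_k; apply: (@wins_query_ladder _ _ _
  (fun i => nth 0 (p ++ q) (f i)) (fun i => nth 0 (p ++ q) (g i)) m) => //.
  by apply: uniq_mkseq2 => //; rewrite ?size_cat /f /g /a /b => i;
    [case: ifP | case: ifP | | | ];
    try (move=> j; case: ifP; case: ifP); lia.
move=> h' u v hh' blue_uv uv_es.
have [i [j [le_i le_j blue_ij]]] : exists i j, [/\ i <= m, j <= m &
    colored_adj h' blue (nth 0 (p ++ q) (a i)) (nth 0 (p ++ q) (b j))].
  have sym_h' := colored_adj_sym h' blue.
  case: uv_es blue_uv => [[i lt_i [[-> ->]|[-> ->]]]|[i le_i [-> ->]]];
    rewrite /f /g; case: (boolP (odd i)) => odd_i /=; rewrite ?odd_i /= => blue_uv.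
  - by exists i.+1, i; split=> //; [lia | rewrite sym_h'].
  - by exists i, i.+1; split=> //; lia.
  - by exists i, i.+1; split=> //; lia.
  - by exists i.+1, i; split=> //; [lia | rewrite sym_h'].
  - by exists i, i; split=> //; rewrite sym_h'.
  by exists i, i.
pose p' := take (a i).+1 p; pose q' := drop j q.
have size_p' : size p' = (a i).+1 by rewrite size_takel // /a; lia.
have size_q' : size q' = size q - j by rewrite size_drop.
rewrite -def_k; apply: (wins_long_path def_k m_gt0 le_kn (s := p' ++ q')).
- apply: subseq_uniq uniq_pq; apply: cat_subseq; first exact: take_subseq.
  exact: drop_subseq.
- rewrite (sorted_cat2 0) ?size_p' ?size_q' //; last by lia.
  rewrite take_sorted ?drop_sorted ?(extends_sorted hh') //= andbT.
  rewrite -nth_last -nth0 size_p' nth_take // nth_drop addn0.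
  have lt_a : a i < size p by rewrite /a; lia.
  have ge_b : (b j < size p) = false by rewrite /b; lia.
  by move: blue_ij; rewrite !nth_cat lt_a ge_b /b addKn.
by rewrite size_cat size_p' size_q' /a; lia.
Qed.

(** * Merging blue paths *)

Lemma wins_query_color (G1 G2 : sgraph) (t : nat) (h : history) (u v : nat) :
  u != v ->
  (forall c h', extends h h' -> colored_adj h' c u v -> wins G1 G2 t h') ->
  wins G1 G2 t.+1 h.
Proof. by move=> neq_uv win_c; apply: (wins_query neq_uv); apply: win_c. Qed.

Lemma sorted_join (e : rel nat) (p q : seq nat) (x y r : nat) :
  symmetric e -> sorted e (rcons p x) -> sorted e (rcons q y) ->
  e x r -> e y r -> sorted e (rcons p x ++ r :: rev (rcons q y)).
Proof.
move=> sym_e path_p path_q e_xr e_yr; rewrite (sorted_cat2 0) ?size_rcons //.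
rewrite path_p last_rcons e_xr -cat1s (sorted_cat2 0) ?size_rev ?size_rcons //.
by rewrite rev_sorted_sym // path_q head_rev_last last_rcons /= sym_e e_yr.
Qed.

(* [hub] is a red path avoiding the blue paths [ss]; the slack above [b] pays for
   the vertices that will be moved from the blue paths to [hub]. *)
Definition merge_state (k b : nat) (h : history) (hub : seq nat)
    (ss : seq (seq nat)) : Prop :=
  [/\ all (sorted (colored_adj h blue)) ss, uniq (hub ++ flatten ss),
      sorted (colored_adj h red) hub, size hub <= k.-1 &
      b + (k.-1 - size hub) + (size ss - 2) < size (flatten ss)].

Lemma merge_state_extends (k b : nat) (h h' : history) (hub : seq nat)
    (ss : seq (seq nat)) :
  extends h h' -> merge_state k b h hub ss -> merge_state k b h' hub ss.
Proof.
move=> hh' [path_ss uniq_ss path_hub size_hub size_ss]; split=> //.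
  by apply: sub_all path_ss => s; apply: extends_sorted.
exact: extends_sorted path_hub.
Qed.

Lemma merge_state_perm (k b : nat) (h : history) (hub : seq nat)
    (ss ss' : seq (seq nat)) :
  perm_eq ss ss' -> merge_state k b h hub ss -> merge_state k b h hub ss'.
Proof.
move=> perm_ss [path_ss uniq_ss path_hub size_hub size_ss]; split=> //.
- by rewrite -(perm_all _ perm_ss).
- by rewrite -(perm_uniq (_ : perm_eq (hub ++ flatten ss) _)) // perm_cat2l perm_flatten.
by rewrite -(perm_size perm_ss) -(perm_size (perm_flatten perm_ss)).
Qed.

(** A path becomes empty when its only remaining vertex moves to the hub. *)
Lemma merge_state_nil (k b : nat) (h : history) (hub : seq nat)
    (ss : seq (seq nat)) :
  merge_state k b h hub ([::] :: ss) -> merge_state k b h hub ss.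
Proof.
move=> [/= path_ss uniq_ss path_hub size_hub size_ss]; split=> //.
by apply: leq_ltn_trans size_ss; lia.
Qed.

(** The blue paths lose one vertex and the hub misses one vertex less, so the slack balances. An
    empty hub takes its first vertex without any red edge. *)
Lemma merge_state_grow (k b : nat) (h : history) (hub p : seq nat) (x : nat)
    (ss : seq (seq nat)) :
  size hub < k.-1 -> (0 < size hub -> colored_adj h red (last 0 hub) x) ->
  merge_state k b h hub (rcons p x :: ss) ->
  merge_state k b h (rcons hub x) (p :: ss).
Proof.
move=> lt_hub red_x [/= /andP [path_p path_ss] uniq_ss path_hub size_hub size_ss].
split=> //=.
- rewrite path_ss andbT.
  by move: path_p; rewrite -cats1 => /cat_sorted2 [].
- by rewrite (perm_uniq (_ : perm_eq _ (hub ++ rcons p x ++ flatten ss))) //; perm_count.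
- case: (hub) path_hub red_x => //= y q path_q red_x.
  by rewrite rcons_path path_q red_x.
- by rewrite size_rcons.
by move: size_ss; rewrite !size_cat !size_rcons; lia.
Qed.

(** The vertex [r] leaves the hub for the merged path. The hub is given up to permutation so that
    [r] can be either of its ends. *)
Lemma merge_state_join (k b : nat) (h : history) (hub hub' p q : seq nat)
    (x y r : nat) (ss : seq (seq nat)) :
  perm_eq hub (r :: hub') -> sorted (colored_adj h red) hub' ->
  colored_adj h blue x r -> colored_adj h blue y r ->
  merge_state k b h hub (rcons p x :: rcons q y :: ss) -> 0 < size ss ->
  merge_state k b h hub' ((rcons p x ++ r :: rev (rcons q y)) :: ss).
Proof.
move=> perm_hub path_hub' blue_x blue_y.
move=> [/= /and3P [path_p path_q path_ss] uniq_ss _ size_hub size_ss] ss_n0.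
have size_hub' := perm_size perm_hub.
split=> //=.
- by rewrite path_ss andbT; apply: sorted_join => //; apply: colored_adj_sym.
- rewrite (perm_uniq (_ : perm_eq _ (hub ++ rcons p x ++ rcons q y ++ flatten ss))) //.
  apply: perm_trans (_ : perm_eq _ ((r :: hub') ++ rcons p x ++ rcons q y ++ flatten ss)) _.
    by perm_count.
  by rewrite perm_cat2r perm_sym.
- by move: size_hub'; rewrite /=; lia.
move: size_ss; rewrite !size_cat /= !size_rev !size_rcons /= in size_hub' *; lia.
Qed.

(** Amortized count: growing the hub takes at most two rounds and releases 2. A join puts one vertex
    back on the list of missing ones but removes a path, which releases 5, enough for the at most
    five rounds it takes. The last [5 * k + 2] rounds are for two paths. *)
Lemma wins_merge (k m n : nat) (h : history) (hub : seq nat) (ss : seq (seq nat)) :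
  k = m.*2.+2 -> 0 < m -> 3 * k <= n -> merge_state k (n + m + k) h hub ss ->
  wins (cycle_graph k) (cycle_graph n)
    (2 * ((k.-1 - size hub) + (size ss - 2)) + 5 * (size ss - 2) + (5 * k + 2)) h.
Proof.
move=> def_k m_gt0 le_kn.
(* Paths weigh two in the measure because a join removes a path but opens a place in the hub. *)
have [d le_d] := ubnP ((k.-1 - size hub) + (size ss).*2).
elim: d h hub ss le_d => // d IHd h hub ss; rewrite ltnS => le_d inv.
have win h' hub' ss' t : merge_state k (n + m + k) h' hub' ss' ->
    (k.-1 - size hub') + (size ss').*2 < (k.-1 - size hub) + (size ss).*2 ->
    2 * ((k.-1 - size hub') + (size ss' - 2)) + 5 * (size ss' - 2) + (5 * k + 2) <= t ->
    wins (cycle_graph k) (cycle_graph n) t h'.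
  move=> inv' lt_d le_t; apply: wins_leq le_t _; apply: IHd inv'.
  exact: leq_trans lt_d le_d.
have [le_ss2 | lt_2ss] := leqP (size ss) 2.
  apply: (@wins_leq _ _ (5 * k + 2)); first by lia.
  case: inv => path_ss uniq_ss _ _ size_ss.
  have [p [q [path_p path_q flat_ss]]] : exists p q : seq nat,
    [/\ sorted (colored_adj h blue) p, sorted (colored_adj h blue) q
      & flatten ss = p ++ q].
    case: (ss) le_ss2 path_ss => [|p [|q [|//]]] _ /=.
    + by exists [::], [::].
    + by rewrite andbT => path_p; exists p, [::].
    by move=> /and3P [path_p path_q _]; exists p, q; rewrite cats0.
  apply: (wins_two_paths def_k m_gt0 le_kn _ path_p path_q); rewrite -flat_ss.
    by move: uniq_ss; rewrite cat_uniq => /and3P [].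
  by apply: leq_trans size_ss; lia.
case: ss le_d inv win lt_2ss => [|p [|q [|z ss]]] //= _ inv win _.
case/lastP: p inv => [|p x] inv.
  by apply: win (merge_state_nil inv) _ _; rewrite /=; lia.
case/lastP: q inv => [|q y] inv.
  have inv' := @merge_state_perm _ _ _ _ _ ([:: [::], rcons p x, z & ss]) _ inv.
  apply: win (merge_state_nil (inv' _)) _ _; rewrite /=; [ | lia | lia].
  by rewrite -(perm_rot 1) /rot /= perm_cons; perm_count.
case/lastP: z inv => [|z w] inv.
  have inv' := @merge_state_perm _ _ _ _ _ ([:: [::], rcons p x, rcons q y & ss]) _ inv.
  apply: win (merge_state_nil (inv' _)) _ _; rewrite /=; [ | lia | lia].
  by perm_count.
have neq_hub u v : u \in hub -> v \in [:: x; y; w] -> v != u.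
  case: inv => _ uniq_ss _ _ _ u_hub v_ss; move: uniq_ss.
  rewrite cat_uniq => /and3P [_ /hasPn /(_ v) notin_hub _].
  apply: contraNneq (notin_hub _) => [-> // |]; move: v_ss.
  by rewrite !inE /= !mem_cat !mem_rcons !inE => /or3P [] ->; rewrite ?orbT.
(* [T0] is the budget left after a join at a full hub: one missing hub vertex and [size ss] paths
   beyond two. *)
set T := (X in wins _ _ X); pose T0 := (size ss).+1 * 2 + 5 * size ss + (5 * k + 2).
have size_hub : size hub <= k.-1 by case: inv.
(* While the hub is not full, two path ends are asked towards its end [r]: a red answer extends the
   hub, two blue ones merge the paths. *)
have [lt_hub | ge_hub] := ltnP (size hub) k.-1.
  case/lastP: hub inv win @T neq_hub size_hub lt_hub => [|hub r] inv win T neq_hub _ lt_hub.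
    by apply: win (merge_state_grow lt_hub _ inv) _ _ => //=; rewrite /T /=; lia.
  rewrite size_rcons in lt_hub.
  apply: (@wins_leq _ _ (T - 2).+2); first by rewrite /T; lia.
  have r_hub : r \in rcons hub r by rewrite mem_rcons mem_head.
  apply: (@wins_query _ _ _ _ x r) => [|h1 hh1 red_x|h1 hh1 blue_x].
  - by rewrite neq_hub ?mem_head.
  - apply: win (merge_state_grow _ _ (merge_state_extends hh1 inv)) _ _ => /=.
    + by rewrite size_rcons.
    + by rewrite last_rcons colored_adj_sym.
    + by rewrite !size_rcons; lia.
    by rewrite /T !size_rcons; lia.
  apply: (@wins_query _ _ _ _ y r) => [|h2 hh2 red_y|h2 hh2 blue_y].
  - by rewrite neq_hub ?inE ?eqxx ?orbT.
  - have inv2 := merge_state_extends (extends_trans hh1 hh2) inv.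
    have perm_ss : perm_eq [:: rcons p x, rcons q y, rcons z w & ss]
        [:: rcons q y, rcons p x, rcons z w & ss] by perm_count.
    apply: win (merge_state_grow _ _ (merge_state_perm perm_ss inv2)) _ _ => /=.
    + by rewrite size_rcons.
    + by rewrite last_rcons colored_adj_sym.
    + by rewrite !size_rcons; lia.
    by rewrite /T !size_rcons; lia.
  have inv2 := merge_state_extends (extends_trans hh1 hh2) inv.
  have path_hub : sorted (colored_adj h2 red) hub.
    by case: inv2 => _ _; rewrite -cats1 => /cat_sorted2 [].
  apply: win (merge_state_join _ path_hub (hh2 _ _ _ blue_x) blue_y inv2 _) _ _ => //=.
  - by rewrite perm_rcons.
  - by rewrite !size_rcons; lia.
  by rewrite /T !size_rcons; lia.
have {size_hub ge_hub} size_hub : size hub = k.-1 by apply/eqP; rewrite eqn_leq size_hub.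
case: hub inv win @T neq_hub size_hub => [|a hub] inv win T neq_hub size_hub.
  by move: size_hub => /=; lia.
pose r := last a hub.
have r_hub : r \in a :: hub by apply: mem_last.
have sizes : T = T0 + 5 by rewrite /T /T0 size_hub; lia.
have join_blue h' p1 x1 q1 y1 s1 :
    merge_state k (n + m + k) h' (a :: hub) [:: rcons p1 x1, rcons q1 y1, s1 & ss] ->
    colored_adj h' blue x1 r -> colored_adj h' blue y1 r ->
    wins (cycle_graph k) (cycle_graph n) T0 h'.
  move=> inv' blue_x blue_y.
  have perm_hub : perm_eq (a :: hub) (r :: belast a hub).
    by rewrite lastI perm_rcons.
  have path_hub : sorted (colored_adj h' red) (belast a hub).
    by case: inv' => _ _; rewrite lastI -cats1 => /cat_sorted2 [].
  have size_b := size_belast a hub.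
  by apply: win (merge_state_join perm_hub path_hub blue_x blue_y inv' _) _ _ => //;
    rewrite /T0 /= size_b; move: size_hub => /=; lia.
(* The full hub followed by [x1] is a red path on [k] vertices, so the edge from [x1] to the other
   end [a] is blue. *)
have forced h' t p1 x1 ss1 :
    merge_state k (n + m + k) h' (a :: hub) (rcons p1 x1 :: ss1) ->
    colored_adj h' red x1 r ->
    (forall h'', extends h' h'' -> colored_adj h'' blue x1 a ->
       wins (cycle_graph k) (cycle_graph n) t h'') ->
    wins (cycle_graph k) (cycle_graph n) t.+1 h'.
  move=> [_ uniq_ss path_hub _ _] red_x win_blue.
  have size_s : (size (rcons hub x1)).+1 = k by rewrite size_rcons; move: size_hub => /=; lia.
  rewrite -size_s; apply: (@wins_forced _ _ _ a (rcons hub x1)).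
  - by case: (hub).
  - apply: subseq_uniq uniq_ss; rewrite /= eqxx -cats1; apply: cat_subseq => //.
    by rewrite sub1seq mem_cat mem_rcons mem_head.
  - by rewrite rcons_path; apply/andP; split; [exact: path_hub | rewrite colored_adj_sym].
  by rewrite last_rcons size_s.
have join_red h' p1 x1 q1 y1 s1 :
    merge_state k (n + m + k) h' (a :: hub) [:: rcons p1 x1, rcons q1 y1, s1 & ss] ->
    colored_adj h' red x1 r -> colored_adj h' red y1 r ->
    wins (cycle_graph k) (cycle_graph n) T0.+2 h'.
  move=> inv' red_x red_y; apply: (forced _ _ _ _ _ inv' red_x) => h1 hh1 blue_x.
  have perm_ss : perm_eq [:: rcons p1 x1, rcons q1 y1, s1 & ss]
      [:: rcons q1 y1, rcons p1 x1, s1 & ss] by perm_count.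
  have inv1 := merge_state_extends hh1 inv'.
  apply: (forced _ _ _ _ _ (merge_state_perm perm_ss inv1) (hh1 _ _ _ red_y)) => h2 hh2 blue_y.
  have inv2 := merge_state_extends hh2 inv1.
  have path_hub : sorted (colored_adj h2 red) hub.
    by case: inv2 => _ _ /path_sorted.
  by apply: win (merge_state_join (perm_refl _) path_hub (hh2 _ _ _ blue_x) blue_y inv2 _) _ _ => //;
    rewrite /T0 /=; move: size_hub => /=; lia.
have join h' c p1 x1 q1 y1 s1 :
    merge_state k (n + m + k) h' (a :: hub) [:: rcons p1 x1, rcons q1 y1, s1 & ss] ->
    colored_adj h' c x1 r -> colored_adj h' c y1 r ->
    wins (cycle_graph k) (cycle_graph n) T0.+2 h'.
  case: c => inv' col_x col_y; first exact: join_red inv' col_x col_y.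
  by apply: winsS; apply: winsS; exact: join_blue inv' col_x col_y.
(* Of the three edges to [r] two get the same color: blue merges through [r] at once, red merges
   through [a] after two forced edges. *)
rewrite sizes -[T0 + 5]/(_) addnC !addSn add0n.
apply: (@wins_query_color _ _ _ _ x r) => [|c1 h1 hh1 col_x].
  by rewrite neq_hub ?mem_head.
apply: (@wins_query_color _ _ _ _ y r) => [|c2 h2 hh2 col_y].
  by rewrite neq_hub ?inE ?eqxx ?orbT.
apply: (@wins_query_color _ _ _ _ w r) => [|c3 h3 hh3 col_w].
  by rewrite neq_hub ?inE ?eqxx ?orbT.
have hh13 := extends_trans hh2 hh3.
have inv3 := merge_state_extends (extends_trans hh1 hh13) inv.
have {col_x} col_x := hh13 _ _ _ col_x; have {col_y} col_y := hh3 _ _ _ col_y.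
have [eq12 | neq12] := eqVneq c1 c2.
  by rewrite -eq12 in col_y; apply: join inv3 col_x col_y.
have [eq13 | neq13] := eqVneq c1 c3.
  have perm_ss : perm_eq [:: rcons p x, rcons q y, rcons z w & ss]
      [:: rcons p x, rcons z w, rcons q y & ss] by perm_count.
  rewrite -eq13 in col_w.
  exact: join (merge_state_perm perm_ss inv3) col_x col_w.
have eq23 : c2 = c3 by case: (c1) (c2) (c3) neq12 neq13 => [] [] [].
have perm_ss : perm_eq [:: rcons p x, rcons q y, rcons z w & ss]
    [:: rcons q y, rcons z w, rcons p x & ss] by perm_count.
rewrite -eq23 in col_w; exact: join (merge_state_perm perm_ss inv3) col_y col_w.
Qed.

(** * Growing the levels *)

(** Nonemptiness keeps the default value of [head] and [last] from ever being a spurious vertex. *)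
Definition segment (h : history) (s : seq nat) : bool :=
  (0 < size s) && sorted (colored_adj h blue) s.

Lemma extends_segments (h h' : history) (ss : seq (seq nat)) :
  extends h h' -> all (segment h) ss -> all (segment h') ss.
Proof.
move=> hh'; apply: sub_all => s /andP [s_n0 path_s].
by rewrite /segment s_n0 (extends_sorted hh').
Qed.

Definition head_attached (h : history) : rel (seq nat) :=
  fun p s => colored_adj h red (last 0 p) (head 0 s).

Lemma subseq_lasts (ss : seq (seq nat)) :
  all (fun s => 0 < size s) ss -> subseq [seq last 0 s | s <- ss] (flatten ss).
Proof.
elim: ss => //= s ss IHss /andP [s_n0 ss_n0].
rewrite -cat1s; apply: cat_subseq (IHss ss_n0).
by rewrite sub1seq; case: s s_n0 => //= x s _; apply: mem_last.
Qed.

(* Level [i + k.-1] is joined to level [i] by a forced blue edge, since the red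
   path through the last vertices of the levels between them has [k] vertices. *)
Lemma wins_join_levels (k n t : nat) (h : history) (A D : seq (seq nat)) :
  1 < k -> size A = k.-1 -> all (segment h) (A ++ D) -> uniq (flatten (A ++ D)) ->
  sorted (colored_adj h red) [seq last 0 s | s <- A ++ D] ->
  path (head_attached h) (last [::] A) D ->
  (forall h' ss, all (segment h') ss -> uniq (flatten ss) -> size ss = k.-1 ->
     size (flatten ss) = size (flatten (A ++ D)) ->
     wins (cycle_graph k) (cycle_graph n) t h') ->
  wins (cycle_graph k) (cycle_graph n) (size D + t) h.
Proof.
move=> k_gt1; elim: D A h => [|s D IHD] A h.
  by rewrite cats0 add0n => size_A seg_A uniq_A _ _ win_t; apply: (win_t h A).
case: A => [|s0 A] size_A seg_A uniq_A red_A att_D win_t; first by move: size_A => /=; lia.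
have /= /andP [/andP [s0_n0 path_s0]] := seg_A.
rewrite all_cat => /andP [seg_A' /= /andP [/andP [s_n0 path_s] seg_D]].
have /= /andP [att_s att_D'] := att_D.
set p := rcons [seq last 0 s | s <- A] (head 0 s).
have size_p : (size p).+1 = k by rewrite size_rcons size_map -/(size (s0 :: A)) size_A; lia.
rewrite -[size (s :: D) + t]/(size D + t).+1 -size_p; apply: (@wins_forced _ _ _ (last 0 s0) p).
- by rewrite /p; case: (map _ _).
- apply: subseq_uniq uniq_A; rewrite /p -rcons_cons -cats1 flatten_cat.
  apply: cat_subseq.
    apply: (@subseq_lasts (s0 :: A)); rewrite /= s0_n0.
    by apply: sub_all seg_A' => q /andP [].
  by rewrite sub1seq /= mem_cat; case: (s) s_n0 => //= x q _; rewrite mem_head.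
- rewrite rcons_path last_map; apply/andP; split.
    by move: red_A; rewrite map_cat => /cat_sorted2 [].
  by move: att_s; rewrite /head_attached /=; case: (A).
rewrite last_rcons size_p => h' hh' blue_s.
have last_s : last 0 (s0 ++ s) = last 0 s by case: (s) s_n0 => // x q _; rewrite last_cat.
have perm_ss : perm_eq (flatten (rcons A (s0 ++ s) ++ D)) (flatten ((s0 :: A) ++ s :: D)).
  by perm_count.
(* The merged level ends in the last vertex of [s], so it takes the place of [s] and the window of
   [k.-1] levels moves up by one. *)
apply: (IHD (rcons A (s0 ++ s))).
- by rewrite size_rcons.
- rewrite -cats1 !all_cat (extends_segments hh' seg_A') (extends_segments hh' seg_D).
  rewrite /= !andbT /segment size_cat addn_gt0 s0_n0 /= (sorted_cat2 0) //.
  by rewrite !(extends_sorted hh') // colored_adj_sym blue_s.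
- by rewrite (perm_uniq perm_ss).
- move: red_A => /= /path_sorted; rewrite !map_cat map_rcons -cats1 -catA /= last_s.
  by apply: extends_sorted hh'.
- rewrite last_rcons; case: (D) att_D' => //= q D' /andP [att_q att_D'].
  rewrite /head_attached last_s (hh' _ _ _ att_q) /=.
  by apply: sub_path att_D' => ? ?; apply: hh'.
by move=> h2 ss; rewrite (perm_size perm_ss); apply: win_t.
Qed.

(** Stacks are listed from the top, so [s] is the level directly above [p]. *)
Definition attached (h : history) : rel (seq nat) :=
  fun s p => head_attached h p s && colored_adj h red (last 0 p) (last 0 s).

Lemma extends_attached (h h' : history) (st : seq (seq nat)) :
  extends h h' -> sorted (attached h) st -> sorted (attached h') st.
Proof.
move=> hh'; apply: sub_sorted => s p /andP [att1 att2].
by apply/andP; split; apply: hh'.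
Qed.

(** Joining levels costs one round per level beyond [k.-1]; the remaining paths are merged starting
    from an empty hub. The size bound is what [merge_state] demands for [k.-1] paths: [n + m + k],
    plus [k - 1] for the hub, plus [k - 3]. *)
Lemma wins_stack (k m n : nat) (h : history) (st : seq (seq nat)) :
  k = m.*2.+2 -> 0 < m -> 3 * k <= n -> all (segment h) st -> uniq (flatten st) ->
  sorted (attached h) st -> n + m + 3 * k - 4 < size (flatten st) ->
  wins (cycle_graph k) (cycle_graph n) (size st + 13 * k) h.
Proof.
move=> def_k m_gt0 le_kn seg_st uniq_st att_st size_st.
have win_ss h' ss : all (segment h') ss -> uniq (flatten ss) -> size ss <= k.-1 ->
    size (flatten ss) = size (flatten st) ->
    wins (cycle_graph k) (cycle_graph n) (size ss + 13 * k) h'.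
  move=> seg_ss uniq_ss size_ss size_fss.
  apply: wins_leq (_ : _ <= _) (@wins_merge k m n h' [::] ss def_k m_gt0 le_kn _).
    by rewrite /=; lia.
  split=> //; first by apply: sub_all seg_ss => s /andP [].
  by rewrite size_fss; apply: leq_ltn_trans size_st; rewrite /=; lia.
have [le_st | lt_st] := leqP (size st) k.-1; first exact: win_ss.
(* Reversed, the stack runs from the bottom up, as [wins_join_levels] expects. *)
have size_A : size (take k.-1 (rev st)) = k.-1 by rewrite size_takel // size_rev ltnW.
have AD := cat_take_drop k.-1 (rev st).
set A := take _ _ in size_A AD; set D := drop _ _ in AD.
have perm_AD : perm_eq (flatten (A ++ D)) (flatten st).
  by apply: perm_flatten; rewrite AD perm_rev.
have size_D : size st = size D + k.-1.
  by rewrite -(size_rev st) -AD size_cat size_A addnC.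
have att_AD : sorted (fun p s => attached h s p) (A ++ D) by rewrite AD rev_sorted.
rewrite size_D -addnA; apply: (@wins_join_levels _ _ _ _ A D) => //.
- by lia.
- by rewrite AD all_rev.
- by rewrite (perm_uniq perm_AD).
- rewrite sorted_map; apply: sub_sorted att_AD => p s /andP [_ red_ps].
  exact: red_ps.
- case: (A) size_A att_AD => [|s0 A']; first by move=> /= ?; lia.
  move=> _ /=; rewrite cat_path => /andP [_].
  by apply: sub_path => p s /andP [].
move=> h' ss seg_ss uniq_ss size_ss size_fss; rewrite -{1}size_ss.
by apply: win_ss; rewrite ?size_ss // size_fss (perm_size perm_AD).
Qed.

Lemma perm_flatten_merge (s p : seq nat) (ss : seq (seq nat)) :
  perm_eq (flatten ((p ++ rev s) :: ss)) (flatten [:: s, p & ss]).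
Proof. by perm_count. Qed.

Lemma perm_flatten_rcons (s : seq nat) (x : nat) (ss : seq (seq nat)) :
  perm_eq (flatten (rcons s x :: ss)) (x :: flatten (s :: ss)).
Proof. by perm_count. Qed.

Lemma neq_last (s p u : seq nat) :
  0 < size s -> 0 < size p -> uniq (s ++ p ++ u) -> last 0 s != last 0 p.
Proof.
case/lastP: s => // s x _; case/lastP: p => // p y _; rewrite !last_rcons.
rewrite cat_uniq => /and3P [_ /hasPn /(_ y) notin_s _].
apply: contraNneq (notin_s _) => [<- | ]; first by rewrite mem_rcons mem_head.
by rewrite mem_cat mem_rcons mem_head.
Qed.

Lemma segment_cat_rev (h : history) (p s : seq nat) :
  segment h p -> segment h s -> colored_adj h blue (last 0 p) (last 0 s) ->
  segment h (p ++ rev s).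
Proof.
move=> /andP [p_n0 path_p] /andP [s_n0 path_s] blue_ps.
rewrite /segment size_cat addn_gt0 p_n0 (sorted_cat2 0) ?size_rev // path_p.
by rewrite rev_sorted_sym ?path_s ?head_rev_last ?blue_ps //; apply: colored_adj_sym.
Qed.

(* Only the head of the topmost segment [s] is known to be attached. If joining
   its last vertex to the level below fails, the two levels merge. *)
Lemma wins_attach (k n t N d : nat) (h : history) (s p : seq nat)
    (st : seq (seq nat)) :
  (forall h' st', all (segment h') st' -> uniq (flatten st') ->
     sorted (attached h') st' -> 0 < size st' -> size (flatten st') + d = N ->
     wins (cycle_graph k) (cycle_graph n) (2 * d + (size st' + t)) h') ->
  all (segment h) (s :: p :: st) -> uniq (flatten (s :: p :: st)) ->
  head_attached h p s -> sorted (attached h) (p :: st) ->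
  size (flatten (s :: p :: st)) + d = N ->
  wins (cycle_graph k) (cycle_graph n) (2 * d + (size (s :: p :: st) + t)).+1 h.
Proof.
move=> win_st; elim: st h s p => [|p' st IHst] h s p seg_st uniq_st att_s att_p size_st;
  have /andP [seg_s /andP [seg_p _]] := seg_st;
  have /andP [s_n0 _] := seg_s; have /andP [p_n0 _] := seg_p;
  have neq_sp := neq_last s_n0 p_n0 uniq_st;
  apply: (wins_query neq_sp) => h' hh' col_sp;
  have seg_st_h' := extends_segments hh' seg_st;
  have /andP [seg_s' /andP [seg_p' seg_st']] := seg_st_h';
  rewrite colored_adj_sym in col_sp.
1,3: apply: (win_st h' (s :: p :: _)) => //;
  rewrite [sorted _ _]/= {1}/attached /head_attached (hh' _ _ _ att_s) col_sp;
  exact: extends_attached hh' att_p.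
- apply: (@wins_leq _ _ (2 * d + (size [:: p ++ rev s] + t))).
    by rewrite leq_add2l leq_add2r.
  apply: (win_st h' [:: _]) => //.
  + by rewrite /= segment_cat_rev.
  + by rewrite (perm_uniq (perm_flatten_merge _ _ _)).
  by rewrite (perm_size (perm_flatten_merge _ _ _)).
have /= /andP [/andP [att_hp _] att_st] := att_p.
(* The merged level starts at the head of [p], which is attached to [p']. The lost level pays for
   the round. *)
apply: (@wins_leq _ _ (2 * d + (size [:: p ++ rev s, p' & st] + t)).+1).
  by rewrite -addnS.
apply: (IHst h' (p ++ rev s) p').
- by apply/andP; rewrite segment_cat_rev.
- by rewrite (perm_uniq (perm_flatten_merge _ _ _)).
- rewrite /head_attached (_ : head 0 (p ++ rev s) = head 0 p); first exact: hh' att_hp.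
  by case: (p) p_n0.
- exact: (@extends_attached _ _ (p' :: st) hh' att_st).
by rewrite (perm_size (perm_flatten_merge _ _ _)).
Qed.

Lemma fresh_vertex (s : seq nat) : exists w, w \notin s.
Proof.
exists (\max_(v <- s) v).+1; apply/negP => w_s.
by have := @leq_bigmax_seq _ s xpredT id _ w_s isT; rewrite ltnn.
Qed.

(** Each vertex still to come has a credit of two rounds and each level a credit of one. A red
    answer spends one round and endows the new level with the other; a blue answer leaves the second
    round for attaching the new end. *)
Lemma wins_grow (k n t N d : nat) (h : history) (st : seq (seq nat)) :
  (forall h' st', all (segment h') st' -> uniq (flatten st') ->
     sorted (attached h') st' -> size (flatten st') = N ->
     wins (cycle_graph k) (cycle_graph n) (size st' + t) h') ->
  all (segment h) st -> uniq (flatten st) -> sorted (attached h) st ->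
  0 < size st -> size (flatten st) + d = N ->
  wins (cycle_graph k) (cycle_graph n) (2 * d + (size st + t)) h.
Proof.
move=> win_N; elim: d h st => [|d IHd] h st seg_st uniq_st att_st st_n0 size_st.
  by apply: win_N => //; rewrite -size_st addn0.
case: st seg_st uniq_st att_st st_n0 size_st => // s st seg_st uniq_st att_st _ size_st.
have [w fresh_w] := fresh_vertex (flatten (s :: st)).
have /= /andP [/andP [s_n0 path_s] seg_st'] := seg_st.
have neq_w : last 0 s != w.
  apply: contraNneq fresh_w => <-; rewrite mem_cat.
  by case: (s) s_n0 => // x s1 _; rewrite [last _ _]/= mem_last.
apply: (@wins_leq _ _ (2 * d + ((size st).+2 + t)).+1); first by rewrite /=; lia.
apply: (wins_query neq_w) => h' hh' col_w.
- apply: (IHd h' ([:: w] :: s :: st)) => //.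
  + by apply/andP; split => //; apply: extends_segments hh' seg_st.
  + by rewrite /= in fresh_w *; rewrite fresh_w.
  + rewrite /= /attached /head_attached /= col_w /=.
    exact: extends_attached hh' att_st.
  by move: size_st; rewrite /= !size_cat; lia.
have seg_w : segment h' (rcons s w).
  rewrite /segment size_rcons -cats1 (sorted_cat2 0) //= col_w !andbT.
  exact: extends_sorted hh' path_s.
have perm_w := perm_flatten_rcons s w st.
have uniq_w : uniq (flatten (rcons s w :: st)) by rewrite (perm_uniq perm_w) /= fresh_w.
have size_w : size (flatten (rcons s w :: st)) + d = N.
  by rewrite (perm_size perm_w) -size_st addSnnS.
case: st seg_st uniq_st att_st size_st fresh_w seg_st' perm_w uniq_w size_w => [|p st].
  move=> _ _ _ _ _ _ _ uniq_w size_w.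
  apply: (@wins_leq _ _ (2 * d + (size [:: rcons s w] + t))); first by rewrite /=; lia.
  by apply: IHd => //=; rewrite seg_w.
move=> _ _ /= /andP [/andP [att_sp _] att_st] _ _ seg_st _ uniq_w size_w.
apply: (@wins_leq _ _ (2 * d + (size [:: rcons s w, p & st] + t)).+1).
  by rewrite -addnS.
apply: (@wins_attach k n t N d h' (rcons s w) p st) => //.
- by apply/andP; split=> //; exact: (@extends_segments _ _ (p :: st) hh' seg_st).
- by rewrite /head_attached; case: (s) s_n0 att_sp => //= x s1 _; apply: hh'.
exact: (@extends_attached _ _ (p :: st) hh' att_st).
Qed.

Theorem theorem1 (k n : nat) (k_ge4 : 4 <= k) (k_even : ~~ odd k)
    (n_ge3k : 3 * k <= n) :
  exists2 r : nat,
    is_online_ramsey (cycle_graph k) (cycle_graph n) r &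
    r <= 2 * n + 20 * k.
Proof.
have def_k : k = (k./2.-1).*2.+2 by lia.
have m_gt0 : 0 < k./2.-1 by lia.
apply: builder_online_ramsey; apply: wins_builder.
(* The least number of vertices accepted by [wins_stack]. Starting from the single vertex [0], the
   total is [2 * N.-1 + 1 + 13 * k], which equals [2 * n + 20 * k - 9]. *)
pose N := n + k./2.-1 + 3 * k - 3.
apply: (@wins_leq _ _ (2 * N.-1 + (size [:: [:: 0]] + 13 * k))).
  by rewrite /N /=; lia.
apply: (@wins_grow _ _ _ N) => //; last by rewrite /N /=; lia.
move=> h st seg_st uniq_st att_st size_st.
by apply: wins_stack def_k m_gt0 n_ge3k seg_st uniq_st att_st _; rewrite size_st /N; lia.
Qed.
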